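(* For any finite simple graphs $G$ and $H$, the lexicographic product $G[H]$ is $k$-indicated colorable for every integer $k\geq \mathrm{col}(G)\,\mathrm{col}(H)$.
   Context: All graphs are finite, simple and undirected. Indicated coloring game on a graph $G$ with a fixed set of $k$ colors: in each round the first player Ann selects an uncolored vertex and the second player Ben assigns it a color from the set so that the partial coloring remains proper. Ann wins if all vertices get colored; Ben wins if at some point there is an uncolored vertex whose neighbors already carry all $k$ colors (a block vertex). $G$ is $k$-indicated colorable if Ann has a winning strategy with $k$ colors (regardless of Ben's play). The coloring number $\mathrm{col}(G)$ is the smallest $d$ such that there is a linear ordering of $V(G)$ in which every vertex has fewer than $d$ neighbors preceding it; equivalently $\mathrm{col}(G)=1+\max_{H'\subseteq G}\delta(H')$. The lexicographic product $G[H]$ has vertex set $V(G)\times V(H)$, with $(x_1,y_1)$ adjacent to $(x_2,y_2)$ iff either $x_1=x_2$ and $y_1y_2\in E(H)$, or $x_1x_2\in E(G)$. *)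

(* Defs.v *)
From mathcomp Require Import all_boot.

Set Implicit Arguments.
Unset Strict Implicit.
Unset Printing Implicit Defensive.

Record sgraph := SGraph {
  vertex :> finType;
  adj : rel vertex;
  adj_sym : symmetric adj;
  adj_irrefl : irreflexive adj
}.

Section LexProduct.
Variables G H : sgraph.

Definition lex_adj : rel (G * H) :=
  fun p q => (p.1 == q.1) && adj p.2 q.2 || adj p.1 q.1.

Lemma lex_adj_sym : symmetric lex_adj.
Proof. by move=> p q; rewrite /lex_adj eq_sym adj_sym (adj_sym p.1). Qed.

Lemma lex_adj_irrefl : irreflexive lex_adj.
Proof. by move=> p; rewrite /lex_adj !adj_irrefl andbF. Qed.

Definition lex_product : sgraph :=
  @SGraph (G * H)%type lex_adj lex_adj_sym lex_adj_irrefl.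
End LexProduct.

Section ColoringNumber.
Variable G : sgraph.

(* A duplicate-free #|G|-tuple lists every vertex exactly once, hence is a
   linear ordering of the vertices. *)
Definition col_bound (d : nat) : bool :=
  [exists s : #|G|.-tuple G, uniq s &&
    [forall x, #|[set y | adj x y & index y s < index x s]| < d]].

Lemma col_bound_ex : exists d, col_bound d.
Proof.
exists #|G|.+1; apply/existsP; exists (enum_tuple G); rewrite enum_uniq /=.
by apply/forallP=> x; rewrite ltnS max_card.
Qed.

(* The graph with no vertices gets coloring number 0. *)
Definition col : nat := ex_minn col_bound_ex.
End ColoringNumber.

Section IndicatedColoring.
Variables (G : sgraph) (k : nat).

Definition pcoloring := {ffun G -> option 'I_k}.

Definition uncolored : pcoloring := [ffun=> None].

Definition assign (c : pcoloring) (v : G) (i : 'I_k) : pcoloring :=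
  [ffun x => if x == v then Some i else c x].

Definition proper (c : pcoloring) : Prop :=
  forall x y i, adj x y -> c x = Some i -> c y <> Some i.

Definition block_vertex (c : pcoloring) (u : G) : Prop :=
  c u = None /\ forall i : 'I_k, exists2 w, adj u w & c w = Some i.

(* A strategy of Ann is a tree, so that her choices may depend on the whole
   history: [Select v next] selects [v] and continues with [next i] once Ben
   has assigned the color [i]. *)
Inductive strategy : Type :=
| Stop
| Select of G & ('I_k -> strategy).

(* [wins s c]: playing [s] from the position [c], Ann wins whatever Ben does.
   Requiring that no block vertex exists also ensures that Ben has a legal
   color for the selected vertex, so the quantification over his answers is
   never vacuous. *)
Fixpoint wins (s : strategy) (c : pcoloring) : Prop :=
  match s with
  | Stop => forall v, c v <> None
  | Select v next =>
      [/\ forall u, ~ block_vertex c u,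
          c v = None
        & forall i, proper (assign c v i) -> wins (next i) (assign c v i)]
  end.

Definition indicated_colorable : Prop := exists s, wins s uncolored.
End IndicatedColoring.

(* Main.v *)
(** Ann processes the fibers of [G[H]] along an optimal ordering of [G], and the
    vertices of each fiber along an optimal ordering of [H].  She leaves a fiber
    as soon as it carries [col H] colors or is completely colored; up to then
    the earlier neighboring fibers forbid at most [(col G - 1) * col H] colors and
    the fiber itself fewer than [col H], so Ben can always answer.  Afterwards
    every fiber that still has uncolored vertices carries [col H] colors, which
    properness bans from the neighboring fibers forever, and these suffice to
    complete the fiber greedily. *)
From mathcomp Require Import all_boot.
Require Import Defs.

Set Implicit Arguments.
Unset Strict Implicit.
Unset Printing Implicit Defensive.

Lemma col_ordering (G : sgraph) : exists2 r : G -> nat, injective r &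
  forall x, #|[set y | adj x y & r y < r x]| < col G.
Proof.
rewrite /col; case: ex_minnP => d /existsP[s /andP[s_uniq /forallP s_bound]] _.
exists (index^~ s) => // x y.
(* [index] is injective on the members of [s], and with [#|G|] distinct entries [s] contains every
   vertex. *)
have /subset_cardP s_full : #|s| = #|G| by rewrite (card_uniqP s_uniq) size_tuple.
by apply: (index_inj x); rewrite (s_full (subset_predT _)).
Qed.

Section Game.
Variables (G : sgraph) (k : nat).
Implicit Types (c : pcoloring G k) (v : G) (i : 'I_k).

Definition free c v i := [forall w, adj v w ==> (c w != Some i)].

Lemma freeP c v i :
  reflect (forall w, adj v w -> c w <> Some i) (free c v i).
Proof.
by apply: (iffP forallP) => h w; [move/(implyP (h w))/eqP | apply/implyP=> /h/eqP].
Qed.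

Lemma assign_eq c v i : assign c v i v = Some i.
Proof. by rewrite ffunE eqxx. Qed.

Lemma assign_neq c v i w : w != v -> assign c v i w = c w.
Proof. by rewrite ffunE => /negPf->. Qed.

Lemma proper_assign c v i : proper c -> free c v i -> proper (assign c v i).
Proof.
move=> c_proper /freeP v_free x y j xy; rewrite !ffunE.
case: eqP xy => [->|_] xy; case: eqP xy => [->|_] xy; first by rewrite adj_irrefl in xy.
- by case=> <-; apply: v_free.
- by move=> cx [ij]; apply: (v_free x); rewrite 1?adj_sym // ij.
- exact: c_proper.
Qed.

Lemma assign_proper_free c v i : proper (assign c v i) -> free c v i.
Proof.
move=> c_proper; apply/freeP=> w vw.
have wv : w != v by apply: contraTneq vw => ->; rewrite adj_irrefl.
by rewrite -(assign_neq c i wv); apply: c_proper vw _; rewrite assign_eq.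
Qed.

Lemma wins_no_block (s : strategy G k) c u : wins s c -> ~ block_vertex c u.
Proof. by case: s => [|v next] /=; [move=> cN [/cN] | case]. Qed.

(** [v] differs from [u], since [i] is free at [v] while [u] sees every color; the neighbors that
    block [u] are colored, hence differ from [v] and keep their colors. *)
Lemma block_assign c v i u :
  c v = None -> free c v i -> block_vertex c u -> block_vertex (assign c v i) u.
Proof.
move=> cv /freeP v_free [cu u_block]; split.
  rewrite assign_neq //; apply/eqP=> uv.
  by have [w uw] := u_block i; apply: v_free; rewrite -uv.
move=> j; have [w uw cw] := u_block j; exists w => //.
by rewrite assign_neq //; apply/eqP=> wv; rewrite wv cv in cw.
Qed.

(* It is enough that the selected vertex has a free color: a block vertex
   stays one for the rest of the game, and Ann could not finish. *)
Lemma invariant_wins (P : pcoloring G k -> Prop) :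
  (forall c u, P c -> proper c -> c u = None -> exists v,
     [/\ c v = None, exists i, free c v i
       & forall i, free c v i -> P (assign c v i)]) ->
  forall c, P c -> proper c -> exists s, wins s c.
Proof.
move=> step c; have [n] := ubnP #|[set v | c v == None]|.
elim: n c => // n IHn c c_lt Pc c_proper.
have [c_full|] := altP (@forallP _ (fun v => c v != None)).
  by exists (Stop _ _) => v; apply/eqP.
case/forallPn=> u /negPn/eqP/(step c u Pc c_proper)[v [cv [i0 i0_free] Pstep]].
have [next next_wins] : exists next : 'I_k -> strategy G k,
    forall i, free c v i -> wins (next i) (assign c v i).
  apply: (@fin_all_exists _ (fun=> strategy G k)
    (fun i s => free c v i -> wins s (assign c v i))) => i.
  (* Ben cannot play a color that is not free, so [Stop] serves there as a dummy continuation. *)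
  have [i_free|] := boolP (free c v i); last by exists (Stop _ _).
  have [||s s_wins] := IHn (assign c v i) _ (Pstep i i_free).
  - rewrite ltnS in c_lt; apply: leq_trans c_lt; apply/proper_card/properP.
    split; last by exists v; rewrite inE ?assign_eq ?cv.
    by apply/subsetP=> w; rewrite !inE ffunE; case: ifP.
  - exact: proper_assign.
  - by exists s.
exists (Select v next); split=> // [w|i /assign_proper_free/next_wins//].
move=> /(block_assign cv i0_free); exact: wins_no_block (next_wins _ i0_free).
Qed.

End Game.

Section LexStrategy.
Variables (G H : sgraph) (k : nat) (rG : G -> nat) (rH : H -> nat).
Hypotheses (rG_inj : injective rG) (rH_inj : injective rH).
Variables dG dH : nat.
Hypothesis rG_bound : forall x, #|[set y | adj x y & rG y < rG x]| < dG.
Hypothesis rH_bound : forall x, #|[set y | adj x y & rH y < rH x]| < dH.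

Implicit Types (c : pcoloring (lex_product G H) k) (x : G) (y : H).

Definition fiber_colors c x := [set i | [exists y, c (x, y) == Some i]].

Definition unfinished c x :=
  (#|fiber_colors c x| < dH) && [exists y, c (x, y) == None].

(** Invariant of Ann's strategy. The last two clauses are conditional on an unfinished fiber, so
    they lapse in the completion phase, where a fiber may exceed [dH] colors. *)
Definition fiberwise_ordered c : Prop :=
  [/\ forall x y y', c (x, y) = None -> c (x, y') <> None -> rH y' < rH y,
      forall x x', unfinished c x -> #|fiber_colors c x'| <= dH
    & forall x x' y', unfinished c x -> c (x', y') <> None -> rG x' <= rG x].

(** The last clause makes [x] the first unfinished fiber while there is one and is vacuous
    afterwards, so one rule serves both phases. *)
Definition next_vertex c x y : Prop :=
  [/\ c (x, y) = None, forall y', c (x, y') = None -> rH y <= rH y'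
    & forall x', unfinished c x' -> unfinished c x /\ rG x <= rG x'].

Lemma mem_fiber_colors c x y i : c (x, y) = Some i -> i \in fiber_colors c x.
Proof. by move=> cxy; rewrite inE; apply/existsP; exists y; rewrite cxy. Qed.

Lemma next_vertex_ex c u : c u = None -> exists x y, next_vertex c x y.
Proof.
case: u => x0 y0 cu.
have [x [y1 cy1] x_min] : exists2 x, exists y, c (x, y) = None &
    forall x', unfinished c x' -> unfinished c x /\ rG x <= rG x'.
  have [x1 x1_open|all_done] := pickP (unfinished c).
    case: (arg_minnP rG x1_open) => x x_open x_min.
    exists x; last by move=> x' /x_min.
    by case/andP: x_open => _ /existsP[y /eqP]; exists y.
  (* Completion phase: any fiber with an uncolored vertex will do. *)
  by exists x0; [exists y0 | move=> x'; rewrite all_done].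
case: (@arg_minnP _ y1 (fun y => c (x, y) == None) rH); first exact/eqP.
move=> y /eqP cxy y_min.
by exists x, y; split=> // y' /eqP /y_min.
Qed.

(** Colored vertices of the fiber precede the uncolored [y], so these colors all occur on the fewer
    than [dH] earlier neighbors of [y]. *)
Lemma card_earlier_colors c x y : fiberwise_ordered c -> c (x, y) = None ->
  #|[set i | [exists y', adj y y' && (c (x, y') == Some i)]]| < dH.
Proof.
move=> [c_ord _ _] cxy; apply: leq_ltn_trans (rH_bound y).
rewrite -(card_imset _ (@Some_inj _)).
apply: leq_trans (leq_imset_card (fun y' => c (x, y')) _).
apply/subset_leq_card/subsetP => _ /imsetP[i + ->]; rewrite inE.
case/existsP=> y' /andP[yy' /eqP cy'].
rewrite -cy'; apply: (imset_f (fun y' => c (x, y'))).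
by rewrite inE yy' (c_ord x) ?cy'.
Qed.

Lemma next_vertex_free c x y : dG * dH <= k -> fiberwise_ordered c -> proper c ->
  next_vertex c x y -> exists i, free c ((x, y) : lex_product G H) i.
Proof.
move=> k_ge c_ord c_proper [cxy _ _]; have := card_earlier_colors c_ord cxy.
set own := [set i | _] => own_lt.
have free_of i : i \notin own ->
    (forall x', adj x x' -> i \notin fiber_colors c x') ->
    free c ((x, y) : lex_product G H) i.
  move=> i_own i_other; apply/freeP=> -[x' y'] /orP[/andP[/= /eqP<- yy'] cy'|/= xx' cy'].
    by case/negP: i_own; rewrite inE; apply/existsP; exists y'; rewrite yy' cy' eqxx.
  by case/negP: (i_other x' xx'); apply: mem_fiber_colors cy'.
have [few|many] := ltnP #|fiber_colors c x| dH; last first.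
  (* Since [own] has fewer than [dH] colors, the fiber carries a color outside it; the vertex
     [(x, y0)] of that color is adjacent to all of every neighboring fiber, so properness keeps the
     color out of them. *)
  have /subsetPn[i] : ~~ (fiber_colors c x \subset own).
    by apply: contraL many => /subset_leq_card le; rewrite -ltnNge (leq_ltn_trans le).
  rewrite inE => /existsP[y0 /eqP cy0] i_own; exists i; apply: free_of => // x' xx'.
  rewrite inE; apply/existsP=> -[y' /eqP]; apply: c_proper cy0.
  by apply/orP; right.
have x_open : unfinished c x.
  by rewrite /unfinished few; apply/existsP; exists y; rewrite cxy.
have [_ c_few c_early] := c_ord.
(* Neighboring fibers after [x] are still uncolored, so only those in [before] forbid colors. *)
pose before := [set x' | adj x x' & rG x' < rG x].
pose other := \bigcup_(x' in before) fiber_colors c x'.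
have other_le : #|other| <= #|before| * dH.
  rewrite /other -sum_nat_const; elim/big_ind2: _ => [|m A n B mA nB|x' _].
  - by rewrite cards0.
  - by apply: leq_trans (leq_card_setU A B).1 _; apply: leq_add.
  - exact: c_few x_open.
have lt_k : #|own :|: other| < #|'I_k|.
  rewrite card_ord; apply: leq_ltn_trans (leq_card_setU _ _).1 _.
  (* The strict bound on [own] leaves fewer than [#|before|.+1 * dH] colors in total, and
     [#|before| < dG]. *)
  apply: leq_trans k_ge; apply: leq_trans (_ : #|before|.+1 * dH <= _).
    by rewrite mulSn -addSn leq_add.
  by rewrite leq_mul ?rG_bound.
have /subsetPn[i _] : ~~ ('I_k \subset own :|: other).
  by apply: contraL lt_k => /subset_leq_card; rewrite -leqNgt.
rewrite in_setU negb_or => /andP[i_own i_other]; exists i; apply: free_of => // x' xx'.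
apply: contra i_other => ix'; apply/bigcupP; exists x' => //.
move: ix'; rewrite !inE xx' => /existsP[y' /eqP cy'] /=.
rewrite ltn_neqAle (c_early x x' y') ?cy' // andbT.
by apply: contraTneq xx' => /rG_inj->; rewrite adj_irrefl.
Qed.

Lemma fiber_colors_assign c x y i x' :
  fiber_colors (assign c ((x, y) : lex_product G H) i) x' \subset
    if x' == x then i |: fiber_colors c x else fiber_colors c x'.
Proof.
apply/subsetP=> j; rewrite inE => /existsP[y']; rewrite ffunE xpair_eqE.
case: (eqVneq x' x) => [->|_] /=; last by move/eqP/mem_fiber_colors.
case: (y' == y) => /eqP; first by case=> ->; rewrite setU11.
by move/mem_fiber_colors=> jx; rewrite in_setU jx orbT.
Qed.

(** A move on an uncolored vertex removes no color from a fiber and uncolors nothing, so a finished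
    fiber never reopens. *)
Lemma unfinished_assign c x y i x' : c (x, y) = None ->
  unfinished (assign c ((x, y) : lex_product G H) i) x' -> unfinished c x'.
Proof.
move=> cxy /andP[few /existsP[y' y'N]]; apply/andP; split; last first.
  by apply/existsP; exists y'; move: y'N; rewrite ffunE; case: ifP.
apply: leq_ltn_trans few; apply/subset_leq_card/subsetP=> j.
rewrite inE => /existsP[z /eqP cz]; apply: (@mem_fiber_colors _ _ z).
by rewrite ffunE; case: eqP => // e; rewrite e cxy in cz.
Qed.

Lemma fiberwise_ordered_assign c x y i : fiberwise_ordered c ->
  next_vertex c x y -> fiberwise_ordered (assign c ((x, y) : lex_product G H) i).
Proof.
move=> [c_ord c_few c_early] [cxy y_min x_min]; split.
- move=> x1 y1 y2; rewrite !ffunE !xpair_eqE.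
  case: (eqVneq x1 x) => [->|_] /=; last exact: c_ord.
  case: (eqVneq y1 y) => //= y1y c1; case: (eqVneq y2 y) => [->|_] /=; last exact: c_ord.
  by rewrite ltn_neqAle y_min // andbT => _; apply: contra_neq y1y => /rH_inj.
- move=> x1 x2 /(unfinished_assign cxy) x1_open.
  apply: leq_trans (subset_leq_card (fiber_colors_assign _ _ _ _ _)) _.
  case: eqP => _; last exact: c_few x1_open.
  (* While some fiber is unfinished, so is the chosen [x]; it had fewer than [dH] colors, and one
     more gives at most [dH]. *)
  have [/andP[few _] _] := x_min _ x1_open.
  by rewrite cardsU1; apply: leq_trans few; rewrite -add1n leq_add2r leq_b1.
- move=> x1 x2 y2 /(unfinished_assign cxy) x1_open; rewrite ffunE xpair_eqE.
  case: (eqVneq x2 x) => [-> _|_] /=; last exact: c_early.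
  by have [] := x_min _ x1_open.
Qed.

Lemma lex_indicated_colorable :
  dG * dH <= k -> indicated_colorable (lex_product G H) k.
Proof.
move=> k_ge; apply: (invariant_wins (P := fiberwise_ordered)).
- move=> c u c_ord c_proper /next_vertex_ex[x [y xy_next]].
  exists (x, y); split; first by case: xy_next.
  + exact: next_vertex_free xy_next.
  + by move=> i _; apply: fiberwise_ordered_assign.
- split=> [x y y' _|x x' _|x x' y' _]; rewrite ?ffunE //.
  rewrite (_ : fiber_colors _ _ = set0) ?cards0 //.
  by apply/setP=> i; rewrite !inE; apply/existsP=> -[y]; rewrite ffunE.
- by move=> p q i _; rewrite ffunE.
Qed.

End LexStrategy.

Theorem theorem2p2 (G H : sgraph) (k : nat) :
  col G * col H <= k -> indicated_colorable (lex_product G H) k.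
Proof.
have [rG rG_inj rG_bound] := col_ordering G.
have [rH rH_inj rH_bound] := col_ordering H.
exact: (lex_indicated_colorable rG_inj rH_inj rG_bound rH_bound).
Qed.
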